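(* (i) Let $(X;\sim,\backsim,\wedge,1)$ be a pseudo equality algebra, and for $a,b\in X$ put $a\to b=(a\wedge b)\sim a$ and $a\rightsquigarrow b=a\backsim(a\wedge b)$. Then $(X;\to,\rightsquigarrow,\wedge,1)$ is a pseudo $BCK$-meet-semilattice satisfying, for all $a,b,c\in X$, $$(\ast)\qquad b\to a\leq (b\wedge c)\to (a\wedge c)\quad\text{and}\quad b\rightsquigarrow a\leq (b\wedge c)\rightsquigarrow (a\wedge c).$$ (ii) Let $(X;\to,\rightsquigarrow,\wedge,1)$ be a pseudo $BCK$-meet-semilattice satisfying $(\ast)$ for all $a,b,c\in X$. Then $(X;\sim,\backsim,\wedge,1)$ is a pseudo equality algebra, where $a\sim b=b\to a$ and $a\backsim b=a\rightsquigarrow b$ for all $a,b\in X$.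
   Context: A pseudo equality algebra is an algebra $(X;\sim,\backsim,\wedge,1)$ of type $(2,2,2,0)$ such that for all $a,b,c\in X$ (with $x\le y$ iff $x\wedge y=x$): (F1) $(X;\wedge,1)$ is a meet-semilattice with top element $1$; (F2) $a\sim a=1=a\backsim a$; (F3) $a\sim 1=a=1\backsim a$; (F4) $a\leq b\leq c$ implies $a\sim c\leq b\sim c$, $a\sim c\leq a\sim b$, $c\backsim a\leq c\backsim b$ and $c\backsim a\leq b\backsim a$; (F5) $a\sim b\leq (a\wedge c)\sim (b\wedge c)$ and $a\backsim b\leq (a\wedge c)\backsim (b\wedge c)$; (F6) $a\sim b\leq (c\sim a)\backsim (c\sim b)$ and $a\backsim b\leq (a\backsim c)\sim (b\backsim c)$; (F7) $a\sim b\leq (a\sim c)\sim (b\sim c)$ and $a\backsim b\leq (c\backsim a)\backsim (c\backsim b)$. A pseudo $BCK$-algebra is an algebra $(X;\to,\rightsquigarrow,1)$ of type $(2,2,0)$ such that for all $a,b,c\in X$: (PBCK1) $(a\to b)\rightsquigarrow ((b\to c)\rightsquigarrow (a\to c))=1$ and $(a\rightsquigarrow b)\to ((b\rightsquigarrow c)\to (a\rightsquigarrow c))=1$; (PBCK2) $1\to a=a$ and $1\rightsquigarrow a=a$; (PBCK3) $a\to 1=1$ and $a\rightsquigarrow 1=1$; (PBCK4) $a\to b=1=b\to a$ implies $a=b$, and $a\rightsquigarrow b=1=b\rightsquigarrow a$ implies $a=b$. In a pseudo $BCK$-algebra, $a\leq b$ iff $a\to b=1$ (equivalently, iff $a\rightsquigarrow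 b=1$) defines a partial order. A pseudo $BCK$-meet-semilattice is an algebra $(X;\to,\rightsquigarrow,\wedge,1)$ of type $(2,2,2,0)$ such that $(X;\to,\rightsquigarrow,1)$ is a pseudo $BCK$-algebra whose underlying partial order is a meet-semilattice with meet operation $\wedge$. *)

(* Defs.v *)
From mathcomp Require Import ssreflect ssrfun ssrbool.

Set Implicit Arguments.
Unset Strict Implicit.
Unset Printing Implicit Defensive.

(* The operations are unbundled and the carrier is an arbitrary type: the same
   carrier, meet and unit are shared by both kinds of algebra. *)

Section PseudoEquality.

Context {X : Type} (sim bsim meet : X -> X -> X) (one : X).

Definition meet_le (x y : X) : Prop := meet x y = x.

Local Notation "a ∼ b" := (sim a b) (at level 45, no associativity).
Local Notation "a ∽ b" := (bsim a b) (at level 45, no associativity).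
Local Notation "a ⊓ b" := (meet a b) (at level 40, left associativity).
Local Notation "a ≤ b" := (meet_le a b) (at level 70, no associativity).

Record meet_semilattice_with_top : Prop := MeetSemilatticeWithTop {
  meet_assoc : associative meet;
  meet_comm : commutative meet;
  meet_idem : forall a, a ⊓ a = a;
  meet_top : forall a, a ≤ one
}.

Record pseudo_equality_algebra : Prop := PseudoEqualityAlgebra {
  pea_F1 : meet_semilattice_with_top;
  pea_F2 : forall a, a ∼ a = one /\ a ∽ a = one;
  pea_F3 : forall a, a ∼ one = a /\ one ∽ a = a;
  pea_F4 : forall a b c, a ≤ b -> b ≤ c ->
    [/\ a ∼ c ≤ b ∼ c, a ∼ c ≤ a ∼ b, c ∽ a ≤ c ∽ b & c ∽ a ≤ b ∽ a];
  pea_F5 : forall a b c,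
    a ∼ b ≤ (a ⊓ c) ∼ (b ⊓ c) /\ a ∽ b ≤ (a ⊓ c) ∽ (b ⊓ c);
  pea_F6 : forall a b c,
    a ∼ b ≤ (c ∼ a) ∽ (c ∼ b) /\ a ∽ b ≤ (a ∽ c) ∼ (b ∽ c);
  pea_F7 : forall a b c,
    a ∼ b ≤ (a ∼ c) ∼ (b ∼ c) /\ a ∽ b ≤ (c ∽ a) ∽ (c ∽ b)
}.

End PseudoEquality.

Section PseudoBCK.

Context {X : Type} (imp rimp : X -> X -> X) (one : X).

Local Notation "a ⟶ b" := (imp a b) (at level 45, no associativity).
Local Notation "a ⇝ b" := (rimp a b) (at level 45, no associativity).

Record pseudo_BCK_algebra : Prop := PseudoBCKAlgebra {
  pbck1 : forall a b c,
    (a ⟶ b) ⇝ ((b ⟶ c) ⇝ (a ⟶ c)) = one /\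
    (a ⇝ b) ⟶ ((b ⇝ c) ⟶ (a ⇝ c)) = one;
  pbck2 : forall a, one ⟶ a = a /\ one ⇝ a = a;
  pbck3 : forall a, a ⟶ one = one /\ a ⇝ one = one;
  pbck4 : forall a b,
    (a ⟶ b = one -> b ⟶ a = one -> a = b) /\
    (a ⇝ b = one -> b ⇝ a = one -> a = b)
}.

Definition bck_le (a b : X) : Prop := a ⟶ b = one.

End PseudoBCK.

Definition is_meet_for {X : Type} (le : X -> X -> Prop) (meet : X -> X -> X)
    : Prop :=
  forall a b, [/\ le (meet a b) a, le (meet a b) b &
    forall c, le c a -> le c b -> le c (meet a b)].

Record pseudo_BCK_meet_semilattice {X : Type}
    (imp rimp meet : X -> X -> X) (one : X) : Prop :=
  PseudoBCKMeetSemilattice {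
    pbckms_BCK : pseudo_BCK_algebra imp rimp one;
    pbckms_meet : is_meet_for (bck_le imp one) meet
  }.

(* Both inequalities are in the order of the pseudo BCK-algebra. *)
Definition meet_compatible {X : Type} (imp rimp meet : X -> X -> X) (one : X)
    : Prop :=
  forall a b c,
    bck_le imp one (imp b a) (imp (meet b c) (meet a c)) /\
    bck_le imp one (rimp b a) (rimp (meet b c) (meet a c)).

(* Main.v *)
Require Import Defs.
From mathcomp Require Import ssreflect ssrfun ssrbool.

(** Both kinds of algebra carry the same order, and each direction of the
    correspondence comes down to recognising that order on the other side.

    From a pseudo equality algebra: [a → b = (a ∧ b) ∼ a] equals [1] exactly
    when [a ≤ b].  The nontrivial half is the inequality [a ≤ (x ∼ a) ∽ x], an
    instance of (F6): if [x ∼ a = 1] it reads [a ≤ x].  The transitivity law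
    (PBCK1) starts from (F6) on the chain [a ∧ b ∧ c ≤ a ∧ b ≤ a], and the two
    sides are then brought into the shape of implications by (F5) and by the
    monotonicity (F4); compatibility with meets is (F5) read on [b ∧ a] and
    [b].

    From a pseudo BCK-meet-semilattice: (F6) is (PBCK1), (F5) is compatibility
    with meets, and (F4) is the monotonicity of implications.  (F7) is (PBCK1)
    with its two premises exchanged; the exchange is the Galois connection
    [a ≤ b → c] iff [b ≤ a ⇝ c].

    Each notion has a left-right symmetry, and it is used to obtain the second
    half of every law from the first: pseudo equality algebras are stable under
    replacing [∼], [∽] by the reversed operations of [∽], [∼], which exchanges
    the derived implications, and pseudo BCK-algebras are stable under
    exchanging [→] and [⇝]. *)

(** * Meet-semilattices with top *)

Section Semilattice.

Context {X : Type} {meet : X -> X -> X} {one : X}.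
Hypothesis S : meet_semilattice_with_top meet one.

Local Notation "a ≤ b" := (meet_le meet a b) (at level 70, no associativity).

Lemma meet_le_trans b a c : a ≤ b -> b ≤ c -> a ≤ c.
Proof. by rewrite /meet_le => ab bc; rewrite -ab -(meet_assoc S) bc. Qed.

Lemma meet_le_antisym a b : a ≤ b -> b ≤ a -> a = b.
Proof. by rewrite /meet_le => ab ba; rewrite -ab (meet_comm S). Qed.

Lemma meet_le_l a b : meet a b ≤ a.
Proof.
by rewrite /meet_le (meet_comm S) (meet_assoc S) (meet_idem S).
Qed.

Lemma meet_le_r a b : meet a b ≤ b.
Proof. by rewrite (meet_comm S); exact: meet_le_l. Qed.

Lemma meet_le_glb a b c : c ≤ a -> c ≤ b -> c ≤ meet a b.
Proof. by rewrite /meet_le => ca cb; rewrite (meet_assoc S) ca cb. Qed.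

End Semilattice.

(** * From pseudo equality algebras to pseudo BCK-meet-semilattices *)

(** The reversal keeps the meet and sends the implication [(a ∧ b) ∼ a] to
    [a ∽ (a ∧ b)] by mere unfolding, so that a fact about the first implication
    of every algebra is a fact about the second one as well. *)
Lemma pseudo_equality_dual {X : Type} {sim bsim meet : X -> X -> X} {one : X} :
  pseudo_equality_algebra sim bsim meet one ->
  pseudo_equality_algebra (fun a b => bsim b a) (fun a b => sim b a) meet one.
Proof.
move=> E; split.
- exact: (pea_F1 E).
- by move=> a; have [] := pea_F2 E a.
- by move=> a; have [] := pea_F3 E a.
- by move=> a b c ab bc; have [] := pea_F4 E ab bc; split.
- by move=> a b c; have [? _] := pea_F5 E b a c; have [_ ?] := pea_F5 E b a c.
- by move=> a b c; have [? _] := pea_F6 E b a c; have [_ ?] := pea_F6 E b a c.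
- by move=> a b c; have [? _] := pea_F7 E b a c; have [_ ?] := pea_F7 E b a c.
Qed.

Section FromPseudoEquality.

Context {X : Type} {sim bsim meet : X -> X -> X} {one : X}.
Hypothesis E : pseudo_equality_algebra sim bsim meet one.

Local Notation "a ≤ b" := (meet_le meet a b) (at level 70, no associativity).
Local Notation "a ⊓ b" := (meet a b) (at level 40, left associativity).
Local Notation imp a b := (sim (meet a b) a).
Local Notation rimp a b := (bsim a (meet a b)).

Let S := pea_F1 E.

(** The pair [a ∼ 1 = a] and [x ∼ 1 = x] turns (F6) into [a ≤ (x ∼ a) ∽ x],
    and [1 ∽ x = x]. *)
Lemma le_of_sim_eq_one x a : sim x a = one -> a ≤ x.
Proof.
move=> xa; have [] := pea_F6 E a one x.
have [-> _] := pea_F3 E a; have [-> _] := pea_F3 E x.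
by rewrite xa; have [_ ->] := pea_F3 E x.
Qed.

Lemma imp_eq_one_iff a b : imp a b = one <-> a ≤ b.
Proof.
split=> [/le_of_sim_eq_one h | ->]; last by have [] := pea_F2 E a.
exact: (meet_le_trans S) h (meet_le_r S a b).
Qed.

Lemma imp_meet_compatible a b c : imp b a ≤ imp (b ⊓ c) (a ⊓ c).
Proof.
have [h _] := pea_F5 E (b ⊓ a) b c.
suff -> : (b ⊓ c) ⊓ (a ⊓ c) = (b ⊓ a) ⊓ c by [].
apply: (meet_le_antisym S).
- apply: (meet_le_glb S).
  + apply: (meet_le_glb S).
    * exact: (meet_le_trans S) (meet_le_l S _ _) (meet_le_l S _ _).
    * exact: (meet_le_trans S) (meet_le_r S _ _) (meet_le_l S _ _).
  + exact: (meet_le_trans S) (meet_le_r S _ _) (meet_le_r S _ _).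
- apply: (meet_le_glb S); apply: (meet_le_glb S); try exact: (meet_le_r S).
  + exact: (meet_le_trans S) (meet_le_l S _ _) (meet_le_l S _ _).
  + exact: (meet_le_trans S) (meet_le_l S _ _) (meet_le_r S _ _).
Qed.

(** With [y = a ∧ b] and [z = a ∧ b ∧ c], (F6) gives
    [a → b = y ∼ a ≤ (z ∼ y) ∽ (z ∼ a)].  Here [z ∼ y] lies above [b → c] and
    [z ∼ a] lies below [a → c]; meeting both arguments with [b → c], which (F5)
    allows, turns the left one into [b → c] itself. *)
Lemma imp_trans_law a b c : imp a b ≤ rimp (imp b c) (imp a c).
Proof.
set y := a ⊓ b; set z := y ⊓ c; set r := imp b c; set s := imp a c.
have zy : z ≤ y := meet_le_l S y c.
have ya : y ≤ a := meet_le_l S a b.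
have z_ac : z ≤ a ⊓ c.
  apply: (meet_le_glb S); last exact: (meet_le_r S).
  exact: (meet_le_trans S) zy ya.
(* (F5) applied to [b ∧ c] and [b], both met with [a]. *)
have r_le : r ≤ sim z y.
  have [+ _] := pea_F5 E (b ⊓ c) b a.
  rewrite (meet_comm S b a) (meet_comm S (b ⊓ c) a) (meet_assoc S a b c).
  exact.
have q_le : sim z a ≤ s by have [] := pea_F4 E z_ac (meet_le_l S a c).
have step : sim y a ≤ bsim (sim z y) (sim z a) by have [] := pea_F6 E y a z.
apply: (meet_le_trans S) step _.
have [_ step] := pea_F5 E (sim z y) (sim z a) r.
apply: (meet_le_trans S) step _.
rewrite (meet_comm S (sim z y)) r_le.
have qr : sim z a ⊓ r ≤ r ⊓ s.
  apply: (meet_le_glb S); first exact: (meet_le_r S).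
  exact: (meet_le_trans S) (meet_le_l S _ _) q_le.
by have [] := pea_F4 E qr (meet_le_l S r s).
Qed.

End FromPseudoEquality.

Lemma BCK_of_pseudo_equality {X : Type} {sim bsim meet : X -> X -> X}
    {one : X} :
  pseudo_equality_algebra sim bsim meet one ->
  let imp := fun a b : X => sim (meet a b) a in
  let rimp := fun a b : X => bsim a (meet a b) in
  pseudo_BCK_meet_semilattice imp rimp meet one /\
  meet_compatible imp rimp meet one.
Proof.
move=> E imp rimp.
have D := pseudo_equality_dual E; have S := pea_F1 E.
have impE a b : imp a b = one <-> meet_le meet a b := imp_eq_one_iff E a b.
have rimpE a b : rimp a b = one <-> meet_le meet a b := imp_eq_one_iff D a b.
have top_l a : meet one a = a by rewrite (meet_comm S); exact: (meet_top S).
split; [split; [split|]|].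
- move=> a b c; split; [apply/rimpE | apply/impE].
  + exact: (imp_trans_law E).
  + exact: (imp_trans_law D).
- by move=> a; rewrite /imp /rimp top_l; exact: (pea_F3 E).
- by move=> a; split; [apply/impE | apply/rimpE]; exact: (meet_top S).
- move=> a b; split.
  + by move=> /impE ab /impE ba; exact: (meet_le_antisym S).
  + by move=> /rimpE ab /rimpE ba; exact: (meet_le_antisym S).
- move=> a b; split=> [||c]; rewrite /bck_le.
  + by apply/impE; exact: (meet_le_l S).
  + by apply/impE; exact: (meet_le_r S).
  + by move=> /impE ca /impE cb; apply/impE; exact: (meet_le_glb S).
- move=> a b c; split; rewrite /bck_le; apply/impE.
  + exact: (imp_meet_compatible E).
  + exact: (imp_meet_compatible D).
Qed.

(** * Pseudo BCK-algebras *)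

Lemma pseudo_BCK_swap {X : Type} {imp rimp : X -> X -> X} {one : X} :
  pseudo_BCK_algebra imp rimp one -> pseudo_BCK_algebra rimp imp one.
Proof.
move=> B; split.
- by move=> a b c; have [] := pbck1 B a b c.
- by move=> a; have [] := pbck2 B a.
- by move=> a; have [] := pbck3 B a.
- by move=> a b; have [] := pbck4 B a b.
Qed.

(** (PBCK1) at [1, a, b] reads [a ⇝ ((a → b) ⇝ b) = 1]; if [a → b = 1], the
    inner implication is [1 ⇝ b = b]. *)
Lemma rimp_eq_one_of_imp {X : Type} {imp rimp : X -> X -> X} {one : X}
    (a b : X) :
  pseudo_BCK_algebra imp rimp one -> imp a b = one -> rimp a b = one.
Proof.
move=> B ab; have [+ _] := pbck1 B one a b.
have [-> _] := pbck2 B a; have [-> _] := pbck2 B b.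
by rewrite ab; have [_ ->] := pbck2 B b.
Qed.

Lemma imp_eq_one_iff_rimp {X : Type} {imp rimp : X -> X -> X} {one : X}
    (a b : X) :
  pseudo_BCK_algebra imp rimp one -> imp a b = one <-> rimp a b = one.
Proof.
move=> B; split; first exact: rimp_eq_one_of_imp.
exact: rimp_eq_one_of_imp _ _ (pseudo_BCK_swap B).
Qed.

Section PseudoBCKTheory.

Context {X : Type} {imp rimp : X -> X -> X} {one : X}.
Hypothesis B : pseudo_BCK_algebra imp rimp one.

Local Notation "a ≤ b" := (bck_le imp one a b) (at level 70, no associativity).

Lemma bck_le_rimp a b : a ≤ b <-> rimp a b = one.
Proof. exact: imp_eq_one_iff_rimp. Qed.

Lemma imp_law a b c : imp a b ≤ rimp (imp b c) (imp a c).
Proof. by apply/bck_le_rimp; have [] := pbck1 B a b c. Qed.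

Lemma rimp_law a b c : rimp a b ≤ imp (rimp b c) (rimp a c).
Proof. by have [] := pbck1 B a b c. Qed.

Lemma one_le a : one ≤ a -> a = one.
Proof. by rewrite /bck_le; have [-> _] := pbck2 B a. Qed.

Lemma bck_le_antisym a b : a ≤ b -> b ≤ a -> a = b.
Proof. by have [h _] := pbck4 B a b. Qed.

Lemma bck_le_refl a : a ≤ a.
Proof.
have := rimp_law one one a; have [_ ->] := pbck2 B one.
by move=> /one_le; have [_ ->] := pbck2 B a.
Qed.

Lemma imp_anti a b c : a ≤ b -> imp b c ≤ imp a c.
Proof.
by move=> ab; have := imp_law a b c; rewrite ab => /one_le/bck_le_rimp.
Qed.

Lemma rimp_anti a b c : a ≤ b -> rimp b c ≤ rimp a c.
Proof.
by move=> /bck_le_rimp ab; have := rimp_law a b c; rewrite ab => /one_le.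
Qed.

Lemma bck_le_trans b a c : a ≤ b -> b ≤ c -> a ≤ c.
Proof.
by move=> /(imp_anti _ _ c) h bc; rewrite /bck_le bc in h; exact: one_le.
Qed.

Lemma le_double_imp a b : a ≤ rimp (imp a b) b.
Proof.
by have := imp_law one a b; have [-> _] := pbck2 B a; have [-> _] := pbck2 B b.
Qed.

(** Applying the antitone map [- ⇝ c] to [a ≤ b → c] produces
    [(b → c) ⇝ c ≤ a ⇝ c], and the left side lies above [b]. *)
Lemma le_rimp_of_le_imp a b c : a ≤ imp b c -> b ≤ rimp a c.
Proof.
by move=> /(rimp_anti _ _ c); exact: bck_le_trans (le_double_imp b c).
Qed.

End PseudoBCKTheory.

Lemma le_imp_of_le_rimp {X : Type} {imp rimp : X -> X -> X} {one : X}
    (a b c : X) :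
  pseudo_BCK_algebra imp rimp one ->
  bck_le imp one a (rimp b c) -> bck_le imp one b (imp a c).
Proof.
move=> B; have B' := pseudo_BCK_swap B.
by move=> /(bck_le_rimp B)/(le_rimp_of_le_imp B')/(bck_le_rimp B).
Qed.

(** This is (PBCK1), [c → b ≤ (b → a) ⇝ (c → a)], with its premises
    exchanged. *)
Lemma imp_prefix_law {X : Type} {imp rimp : X -> X -> X} {one : X}
    (a b c : X) :
  pseudo_BCK_algebra imp rimp one ->
  bck_le imp one (imp b a) (imp (imp c b) (imp c a)).
Proof. by move=> B; apply: (le_imp_of_le_rimp _ _ _ B); exact: imp_law. Qed.

Lemma imp_mono {X : Type} {imp rimp : X -> X -> X} {one : X}
    (a b c : X) :
  pseudo_BCK_algebra imp rimp one ->
  bck_le imp one a b -> bck_le imp one (imp c a) (imp c b).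
Proof.
move=> B ab; have := imp_prefix_law b a c B.
by rewrite ab => /(one_le B).
Qed.

(** * From pseudo BCK-meet-semilattices to pseudo equality algebras *)

Lemma semilattice_of_BCK {X : Type} {imp rimp meet : X -> X -> X} {one : X} :
  pseudo_BCK_meet_semilattice imp rimp meet one ->
  meet_semilattice_with_top meet one /\
  (forall a b, meet_le meet a b <-> bck_le imp one a b).
Proof.
case=> B M.
have lel a b : bck_le imp one (meet a b) a by have [] := M a b.
have ler a b : bck_le imp one (meet a b) b by have [] := M a b.
have glb a b c : bck_le imp one c a -> bck_le imp one c b ->
  bck_le imp one c (meet a b) by have [_ _] := M a b; apply.
have tr b a c := bck_le_trans B b a c.
have leE a b : meet_le meet a b <-> bck_le imp one a b.
  split=> [<- //|ab]; apply: (bck_le_antisym B) => //.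
  by apply: (glb _ _ _) => //; exact: (bck_le_refl B).
split=> //; split.
- move=> a b c; apply: (bck_le_antisym B).
  + apply: (glb _ _ _); last exact: tr (ler _ _) (ler _ _).
    by apply: (glb _ _ _) => //; exact: tr (ler _ _) (lel _ _).
  + apply: (glb _ _ _); first exact: tr (lel _ _) (lel _ _).
    by apply: (glb _ _ _) => //; exact: tr (lel _ _) (ler _ _).
- by move=> a b; apply: (bck_le_antisym B); apply: (glb _ _ _).
- by move=> a; apply/leE; exact: (bck_le_refl B).
- by move=> a; apply/leE; rewrite /bck_le; have [] := pbck3 B a.
Qed.

Lemma pseudo_equality_of_BCK {X : Type} {imp rimp meet : X -> X -> X}
    {one : X} :
  pseudo_BCK_meet_semilattice imp rimp meet one ->
  meet_compatible imp rimp meet one ->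
  pseudo_equality_algebra (fun a b => imp b a) (fun a b => rimp a b) meet one.
Proof.
move=> L C; have [S leE] := semilattice_of_BCK L.
have B := pbckms_BCK L; have B' := pseudo_BCK_swap B.
have leE' a b : meet_le meet a b <-> bck_le rimp one a b.
  exact: iff_trans (leE a b) (bck_le_rimp B a b).
split.
- exact: S.
- by move=> a; split; [exact: (bck_le_refl B) | exact: (bck_le_refl B')].
- by move=> a; exact: (pbck2 B).
- move=> a b c ab bc; split.
  + by apply/leE; apply: (imp_mono _ _ _ B); apply/leE.
  + by apply/leE; apply: (imp_anti B); apply/leE.
  + by apply/leE'; apply: (imp_mono _ _ _ B'); apply/leE'.
  + by apply/leE'; apply: (imp_anti B'); apply/leE'.
- move=> a b c; split; apply/leE.
  + by have [] := C a b c.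
  + by have [] := C b a c.
- move=> a b c; split; apply/leE.
  + exact: (imp_law B).
  + exact: (rimp_law B).
- move=> a b c; split; [apply/leE | apply/leE'].
  + exact: (imp_prefix_law _ _ _ B).
  + exact: (imp_prefix_law _ _ _ B').
Qed.

Theorem theorem3p3 (X : Type) :
  (forall (sim bsim meet : X -> X -> X) (one : X),
     pseudo_equality_algebra sim bsim meet one ->
     let imp := fun a b : X => sim (meet a b) a in
     let rimp := fun a b : X => bsim a (meet a b) in
     pseudo_BCK_meet_semilattice imp rimp meet one /\
     meet_compatible imp rimp meet one) /\
  (forall (imp rimp meet : X -> X -> X) (one : X),
     pseudo_BCK_meet_semilattice imp rimp meet one ->
     meet_compatible imp rimp meet one ->
     let sim := fun a b : X => imp b a in
     let bsim := fun a b : X => rimp a b in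
     pseudo_equality_algebra sim bsim meet one).
Proof.
split=> [sim bsim meet one | imp rimp meet one].
- exact: BCK_of_pseudo_equality.
- exact: pseudo_equality_of_BCK.
Qed.
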